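(* For every integer $k \ge 2$, there exists a graph of order $4k+1$ whose Seidel matrix $S$ is singular and such that $S$ has no eigenvector corresponding to the eigenvalue $0$ all of whose entries belong to $\{1,-1\}$ (equivalently, no vector $x\in\{\pm 1\}^{4k+1}$ satisfies $Sx=0$).
   Context: All graphs are simple, undirected, finite, with at least one vertex. The order of a graph is its number of vertices. For a graph $G$ with vertices $v_1,\dots,v_n$ and adjacency matrix $A$, the Seidel matrix of $G$ is the $n\times n$ matrix $S=J_n-I_n-2A$, where $J_n$ is the all-ones matrix and $I_n$ the identity matrix. *)

(* Defs.v *)
(* MathComp *)
From HB Require Import structures.
From mathcomp Require Import all_boot all_order all_algebra.

Set Implicit Arguments.
Unset Strict Implicit.
Unset Printing Implicit Defensive.

Import Order.TTheory GRing.Theory Num.Theory.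
Local Open Scope ring_scope.

(* The vertices v_1, ..., v_n are represented by the ordinals 0, ..., n-1. *)
Record graph (n : nat) := Graph {
  adj : rel 'I_n;
  adj_sym : symmetric adj;
  adj_irr : irreflexive adj
}.

Definition adjmx (R : pzRingType) (n : nat) (G : graph n) : 'M[R]_n :=
  \matrix_(i < n, j < n) (adj G i j)%:R.

Definition seidel (R : pzRingType) (n : nat) (G : graph n) : 'M[R]_n :=
  const_mx 1 - 1%:M - 2%:R *: adjmx R G.

(* Column convention S x = a x; the library's eigenspace is made of rows. *)
Definition eigenvector (R : fieldType) (n : nat) (S : 'M[R]_n) (a : R)
    (x : 'cV[R]_n) : Prop :=
  x != 0 /\ S *m x = a *: x.

Definition pm1_vector (R : pzRingType) (n : nat) (x : 'cV[R]_n) : Prop :=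
  forall i : 'I_n, x i 0 = 1 \/ x i 0 = -1.

(* Main.v *)
Require Import Defs.
From mathcomp Require Import all_boot all_order all_algebra.
From mathcomp Require Import zify ring lra.
Local Open Scope ring_scope.

(**
   Writing [c] for the sum of the entries of [x], the equation [S x = 0] says
   that [x i + 2 * (sum of x over the neighbours of i) = c] for every [i].
   Take the disjoint union of a bull (a triangle with pendant vertices at two
   of its corners) and [k - 1] paths with four vertices. The weights
   [-1; 1, 1, 1, 1] on the bull and [-3, 3, 3, -3] on each path solve these
   equations with [c = 3]. If all entries of [x] are [1] or [-1], the equations
   on a path force [c = 1] or [c = -1], and those on the bull then force the
   degree-two corner of the triangle to have weight [- 3 * c].
*)

Set Implicit Arguments.
Unset Strict Implicit.
Unset Printing Implicit Defensive.

Import Order.TTheory GRing.Theory Num.Theory.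

(* The vertices [4 * q + 1, ..., 4 * q + 4] form a path in this order;
   the bull is the path [1, 2, 3, 4] together with [0], joined to [2] and [3]. *)
Definition bull_paths_arc (i j : nat) : bool :=
  (j == i.+1) && ~~ (4 %| i)%N || (i == 0%N) && ((j == 2) || (j == 3)).

Definition bull_paths_adj (i j : nat) : bool :=
  bull_paths_arc i j || bull_paths_arc j i.

Lemma bull_paths_adj_sym n :
  symmetric (fun i j : 'I_n => bull_paths_adj i j).
Proof. by move=> i j; rewrite /bull_paths_adj orbC. Qed.

Lemma bull_paths_adj_irr n :
  irreflexive (fun i j : 'I_n => bull_paths_adj i j).
Proof. by move=> i; rewrite /bull_paths_adj /bull_paths_arc; lia. Qed.

Definition bull_paths (n : nat) : graph n :=
  Graph (@bull_paths_adj_sym n) (@bull_paths_adj_irr n).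

Section SeidelRows.

Variables (R : realFieldType) (n : nat) (x : nat -> R).

Lemma seidel_mulmxE (G : graph n) (X : 'cV[R]_n) (i : 'I_n) :
  (seidel R G *m X) i 0 =
    \sum_j X j 0 - X i 0 - 2%:R * \sum_(j | adj G i j) X j 0.
Proof.
rewrite !mulmxBl mul1mx -scalemxAl !mxE; congr (_ - _ - _ * _).
  by apply: eq_bigr => j _; rewrite mxE mul1r.
rewrite [RHS]big_mkcond; apply: eq_bigr => j _.
by rewrite mxE; case: ifP => _; rewrite ?mul1r ?mul0r.
Qed.

(** The neighbourhood enters as an explicit duplicate-free list [s], so that a row of the system
    becomes an equation in a few named entries. Indexing [x] by [nat] lets these be written without
    ordinals. *)
Lemma bull_paths_row (i : 'I_n) (s : seq nat) :
    uniq s -> all (ltn^~ n) s ->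
    (forall j, (j \in s) = bull_paths_adj i j) ->
  (seidel R (bull_paths n) *m \col_(j < n) x j) i 0 =
    \sum_(j < n) x j - x i - 2%:R * \sum_(j <- s) x j.
Proof.
move=> uniq_s /allP lt_s mem_s; rewrite seidel_mulmxE mxE.
congr (_ - _ - _ * _); first by apply: eq_bigr => j _; rewrite mxE.
under eq_bigr => j _ do rewrite mxE.
rewrite /= -(big_mkord (bull_paths_adj i) x) -big_filter; apply: perm_big.
apply: uniq_perm => // [|j]; first by rewrite filter_uniq ?iota_uniq.
rewrite mem_filter mem_index_iota -mem_s.
by case: (boolP (j \in s)) => // /lt_s.
Qed.

End SeidelRows.

Section BullPathsKernel.

Variables (R : realFieldType) (k : nat) (x : nat -> R).

Let n := (4 * k + 1)%N.
Let c : R := \sum_(j < n) x j.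
Let in_kernel := seidel R (bull_paths n) *m \col_(j < n) x j = 0.

(** Pendant vertices of the bull and ends of the paths have one neighbour each and share a pattern,
    so their equations start at [q = 0]. The inner equations start at [q = 1], because 2 and 3 have
    the extra neighbour 0. *)
Lemma bull_paths_kernelP : (0 < k)%N ->
  in_kernel <->
  [/\ x 0 + 2 * (x 2 + x 3) = c, x 2 + 2 * (x 0 + x 1 + x 3) = c,
      x 3 + 2 * (x 0 + x 2 + x 4) = c,
      (forall q, (q < k)%N ->
        x (4 * q + 1)%N + 2 * x (4 * q + 2)%N = c /\
        x (4 * q + 4)%N + 2 * x (4 * q + 3)%N = c) &
      forall q, (0 < q < k)%N ->
        x (4 * q + 2)%N + 2 * (x (4 * q + 1)%N + x (4 * q + 3)%N) = c /\
        x (4 * q + 3)%N + 2 * (x (4 * q + 2)%N + x (4 * q + 4)%N) = c].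
Proof.
move=> k_gt0.
have row i s (lt_i : (i < n)%N) : uniq s -> all (ltn^~ n) s ->
    (forall j, (j \in s) = bull_paths_adj i j) ->
    (seidel R (bull_paths n) *m \col_(j < n) x j) (Ordinal lt_i) 0 =
    c - x i - 2%:R * \sum_(j <- s) x j.
  exact: (bull_paths_row x (i := Ordinal lt_i)).
(* Only 0, 2 and 3 meet the edges at the vertex 0; all others, including the pendants 1 and 4,
   follow the path pattern modulo 4. *)
pose nbr i : seq nat :=
  if i == 0%N then [:: 2; 3] else
  if i == 2%N then [:: 0%N; 1; 3] else
  if i == 3%N then [:: 0%N; 2; 4] else
  if (i %% 4 == 1)%N then [:: i.+1] else
  if (i %% 4 == 0)%N then [:: i.-1] else [:: i.-1; i.+1].
have rowE i (lt_i : (i < n)%N) :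
    (seidel R (bull_paths n) *m \col_(j < n) x j) (Ordinal lt_i) 0 =
    c - x i - 2%:R * \sum_(j <- nbr i) x j.
  apply: row; rewrite /nbr /n in lt_i *.
  - by do 5?case: ifP => ?; rewrite /= ?inE //; lia.
  - by do 5?case: ifP => ?; rewrite /= //; lia.
  move=> j; rewrite /bull_paths_adj /bull_paths_arc.
  by do 5?case: ifP => ?; rewrite !inE; lia.
have kerE : in_kernel <->
    forall i, (i < n)%N -> x i + 2 * \sum_(j <- nbr i) x j = c.
  split=> [ker i lt_i | eqs].
    by have := rowE i lt_i; rewrite ker mxE => /eqP; lra.
  apply/colP => -[i lt_i]; rewrite rowE mxE -(eqs i lt_i); ring.
have nbr1 q : nbr (4 * q + 1)%N = [:: (4 * q + 2)%N].
  by rewrite /nbr; do 5?case: ifP => ?; try lia; congr [:: _]; lia.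
have nbr4 q : nbr (4 * q + 4)%N = [:: (4 * q + 3)%N].
  by rewrite /nbr; do 5?case: ifP => ?; try lia; congr [:: _]; lia.
have nbr2 q : (0 < q)%N ->
    nbr (4 * q + 2)%N = [:: (4 * q + 1)%N; (4 * q + 3)%N].
  by move=> ?; rewrite /nbr; do 5?case: ifP => ?; try lia; congr [:: _; _]; lia.
have nbr3 q : (0 < q)%N ->
    nbr (4 * q + 3)%N = [:: (4 * q + 2)%N; (4 * q + 4)%N].
  by move=> ?; rewrite /nbr; do 5?case: ifP => ?; try lia; congr [:: _; _]; lia.
rewrite kerE; split=> [eqs | [e0 e2 e3 leaf inner] i lt_i].
  split=> [|||q lt_q|q /andP[q_gt0 lt_q]].
  - have := eqs 0%N; rewrite /n /= !big_cons big_nil addr0; apply; lia.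
  - have := eqs 2%N; rewrite /n /= !big_cons big_nil addr0 !addrA; apply; lia.
  - have := eqs 3%N; rewrite /n /= !big_cons big_nil addr0 !addrA; apply; lia.
  - have := eqs (4 * q + 1)%N; have := eqs (4 * q + 4)%N.
    rewrite nbr1 nbr4 !big_seq1 /n => e4 e1.
    by split; [apply: e1 | apply: e4]; lia.
  have := eqs (4 * q + 2)%N; have := eqs (4 * q + 3)%N.
  rewrite nbr2 // nbr3 // !big_cons !big_nil !addr0 /n => e3 e2.
  by split; [apply: e2 | apply: e3]; lia.
have [->|i_gt0] := posnP i; first by rewrite !big_cons big_nil addr0.
have [->|i_neq2] := eqVneq i 2.
  by rewrite !big_cons big_nil addr0 !addrA in e2 *.
have [->|i_neq3] := eqVneq i 3.
  by rewrite !big_cons big_nil addr0 !addrA in e3 *.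
(* A block ends at a multiple of 4, hence the predecessor before dividing. *)
pose q := (i.-1 %/ 4)%N.
have lt_q : (q < k)%N by rewrite /n in lt_i; rewrite /q; lia.
have : [|| i == 4 * q + 1, i == 4 * q + 2, i == 4 * q + 3 | i == 4 * q + 4]%N.
  by rewrite /q; lia.
case/or4P=> /eqP Ei; rewrite Ei.
- by rewrite nbr1 big_seq1; case: (leaf q lt_q).
- have q_gt0 : (0 < q)%N by lia.
  rewrite nbr2 // !big_cons big_nil addr0.
  by case: (inner q); rewrite ?q_gt0.
- have q_gt0 : (0 < q)%N by lia.
  rewrite nbr3 // !big_cons big_nil addr0.
  by case: (inner q); rewrite ?q_gt0.
by rewrite nbr4 big_seq1; case: (leaf q lt_q).
Qed.

End BullPathsKernel.

Definition bull_paths_weight (R : realFieldType) (i : nat) : R :=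
  if i == 0%N then -1 else if (i <= 4)%N then 1 else
  if (i %% 4 == 2)%N || (i %% 4 == 3)%N then 3 else -3.

Lemma bull_paths_weight_path (R : realFieldType) (q : nat) : (0 < q)%N ->
  [/\ bull_paths_weight R (4 * q + 1) = -3, bull_paths_weight R (4 * q + 2) = 3,
      bull_paths_weight R (4 * q + 3) = 3 & bull_paths_weight R (4 * q + 4) = -3].
Proof.
by move=> q_gt0; rewrite /bull_paths_weight; split; do 3?case: ifP => //; lia.
Qed.

(** The bull contributes [-1 + 4 = 3], and each path [-3 + 3 + 3 - 3 = 0]; the induction starts at
    the bull alone and adds one path at a time. *)
Lemma sum_bull_paths_weight (R : realFieldType) (k : nat) : (0 < k)%N ->
  \sum_(j < 4 * k + 1) bull_paths_weight R j = 3.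
Proof.
case: k => // k _; elim: k => [|k IHk].
  by rewrite !big_ord_recr big_ord0 /bull_paths_weight /=; ring.
have [w1 w2 w3 w4] := bull_paths_weight_path R (ltn0Sn k).
have -> : (4 * k.+2 + 1)%N = (4 * k.+1 + 1).+4 by lia.
rewrite 4!big_ord_recr /= IHk -!addnS w1 w2 w3 w4; ring.
Qed.

Lemma bull_paths_weight_kernel (R : realFieldType) (k : nat) : (0 < k)%N ->
  seidel R (bull_paths (4 * k + 1)) *m
    \col_(j < 4 * k + 1) bull_paths_weight R j = 0.
Proof.
move=> k_gt0; apply/bull_paths_kernelP; rewrite // sum_bull_paths_weight //.
split; try by rewrite /bull_paths_weight /=; ring.
  move=> [|q] _; first by split; rewrite /bull_paths_weight /=; ring.
  by have [-> -> -> ->] := bull_paths_weight_path R (ltn0Sn q); split; ring.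
move=> q /andP[q_gt0 _].
by have [-> -> -> ->] := bull_paths_weight_path R q_gt0; split; ring.
Qed.

(** The bound [1 < k] supplies the path 5, 6, 7, 8, which determines [c] up to sign; the
    contradiction then comes from the bull. *)
Lemma bull_paths_kernel_not_pm1 (R : realFieldType) (k : nat)
    (X : 'cV[R]_(4 * k + 1)) :
  (1 < k)%N -> seidel R (bull_paths (4 * k + 1)) *m X = 0 -> ~ pm1_vector X.
Proof.
move=> k_gt1 SX0 Xpm1.
(* [X] is extended by 0 beyond its last index. *)
pose x j := oapp (X^~ 0) 0 (insub j : option 'I_(4 * k + 1)).
have XE : X = \col_(j < 4 * k + 1) x j by apply/colP => j; rewrite mxE /x valK.
have xpm1 j : (j < 4 * k + 1)%N -> x j = 1 \/ x j = -1.
  by move=> lt_j; rewrite /x insubT; apply: Xpm1.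
move: SX0; rewrite XE => /bull_paths_kernelP[|e0 _ _ leaf inner]; first by lia.
have [/= l1 l4] := leaf 0%N (ltnW k_gt1); have [/= l5 _] := leaf 1%N k_gt1.
have [/= i6 _] := inner 1%N k_gt1.
clearbody x; move: (\sum_j _) e0 l1 l4 l5 i6 {X Xpm1 XE leaf inner} => c.
have x0 := xpm1 0%N ltac:(lia); have x1 := xpm1 1%N ltac:(lia).
have x2 := xpm1 2%N ltac:(lia); have x3 := xpm1 3%N ltac:(lia).
have x4 := xpm1 4%N ltac:(lia); have x5 := xpm1 5%N ltac:(lia).
have x6 := xpm1 6%N ltac:(lia); have x7 := xpm1 7%N ltac:(lia).
rewrite /muln /= => e0 l1 l4 l5 i6.
(* If [x 5 = x 6], then [c = 3 * x 6] by [l5], and [i6] would give [x 7 = 0]. So [x 5 = - x 6] and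
   [c = x 6]. *)
have c_pm1 : c = 1 \/ c = -1.
  by case: x5 x6 x7 => [] e5 [] e6 [] e7; rewrite e5 e6 e7 in l5 i6; lra.
(* In [x 1 + 2 * x 2 = c], equal signs would give [c] absolute value 3; so [x 1 = - x 2]. The other
   pendant, 4, gives [x 3 = c] likewise. *)
have x2c : x 2 = c.
  by case: x1 x2 c_pm1 => [] e1 [] e2 [] ec; rewrite e1 e2 ec in l1 *; lra.
have x3c : x 3 = c.
  by case: x4 x3 c_pm1 => [] e4 [] e3 [] ec; rewrite e4 e3 ec in l4 *; lra.
by rewrite x2c x3c in e0; case: x0 c_pm1 => [] e [] ec; rewrite e ec in e0; lra.
Qed.

Theorem theorem4p1 (R : realFieldType) (k : nat) (hk : (2 <= k)%N) :
  exists G : graph (4 * k + 1)%N,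
    seidel R G \notin unitmx /\
    ~ (exists x : 'cV[R]_(4 * k + 1),
         eigenvector (seidel R G) 0 x /\ pm1_vector x).
Proof.
exists (bull_paths (4 * k + 1)); split; last first.
  move=> [X [[_ SX0] /bull_paths_kernel_not_pm1]]; apply=> //.
  by rewrite SX0 scale0r.
(* An inverse of the Seidel matrix would make the weight vector zero, but its entry at 0 is [-1]. *)
apply/negP => S_unit; have k_gt0 : (0 < k)%N by lia.
have /(congr1 (mulmx (invmx (seidel R (bull_paths (4 * k + 1)))))) :=
  bull_paths_weight_kernel R k_gt0.
have lt0 : (0 < 4 * k + 1)%N by lia.
rewrite mulKmx // mulmx0 => /colP/(_ (Ordinal lt0)); rewrite !mxE.
by rewrite /bull_paths_weight /=; lra.
Qed.
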